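(* For all even integers $n\geq 0$ we have $$\sum_{k=1}^\infty\frac{4^k}{\binom{2k}{k}k(2k+n)} =\frac{\binom{n}{n/2}}{2^{n+2}}\left(\pi^2+2\sum_{j=1}^{n/2}\frac{4^j}{\binom{2j}{j}j^2}\right),$$ and for all odd integers $n\geq 1$, $$\sum_{k=1}^\infty\frac{4^k}{\binom{2k}{k}k(2k+n)} =\frac{2^n}{\binom{n-1}{\frac{n-1}{2}}n}\sum_{j=0}^{\frac{n-1}{2}}\frac{\binom{2j}{j}}{(2j+1)4^j}.$$
   Context: Empty sums are equal to $0$. *)

(* Defs.v *)
From Stdlib Require Export Reals Arith.
From Coquelicot Require Export Coquelicot.

Open Scope R_scope.

(* [Binomial.C] is the real-valued binomial coefficient; the unqualified [C]
   is Coquelicot's type of complex numbers. *)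
Definition binom (n k : nat) : R := Binomial.C n k.

Definition summand (n k : nat) : R :=
  4 ^ k / (binom (2 * k) k * INR k * (2 * INR k + INR n)).

(* Main.v *)
(** Write [a k = 4 ^ k / binom (2 k) k], [s n] for the sum of the series and
    [K n] for the integral of [x sin^n x] over [[0, PI/2]].  Since
    [(2k+1) a (k+1) = 2 (k+1) a k], the series [(n+2) s (n+2) - (n+1) s n]
    telescopes to [2 / (n+2)]; integration by parts gives the same recurrence
    for [2 K], and both formulas of the theorem follow from it once
    [s 1 = 2 = 2 K 1] and [s 0 = PI^2/4 = 2 K 0] are known.  The first series
    telescopes.  For the second, [D = s - 2 K] vanishes at odd indices and
    satisfies [D 0 = a m * D (2m)].  As [s] and [K] are decreasing, [D (2m)] is
    at most [2 (K (2m-1) - K (2m+1)) = O(1/m)] in absolute value, whereas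
    [a m = O(sqrt m)]; hence [D 0 = 0]. *)
Require Import Defs.
From Stdlib Require Import Reals Arith Lra Lia.
From Coquelicot Require Import Coquelicot.
Open Scope R_scope.

(** * Telescoping sums and the growth of 4^k / binom(2k, k) *)

Lemma is_series_telescope (b : nat -> R) (l : R) :
  is_lim_seq b l -> is_series (fun k => b k - b (S k)) (b O - l).
Proof.
  intros Hb.
  assert (H : is_lim_seq (sum_n (fun k => b k - b (S k))) (b O - l)).
  { apply is_lim_seq_ext with (fun n => b O - b (S n)).
    - induction n as [|n IH].
      + now rewrite sum_O.
      + rewrite sum_Sn, <- IH. unfold plus; simpl. ring.
    - apply (is_lim_seq_minus' (fun _ => b O)).
      + apply is_lim_seq_const.
      + now apply is_lim_seq_incr_1 in Hb. }
  exact H.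
Qed.

Lemma binom_pos (n k : nat) : 0 < binom n k.
Proof.
  unfold binom, Binomial.C. apply Rdiv_lt_0_compat.
  - apply INR_fact_lt_0.
  - apply Rmult_lt_0_compat; apply INR_fact_lt_0.
Qed.

Lemma central_binom_succ (k : nat) :
  binom (2 * S k) (S k) =
  binom (2 * k) k * (2 * (2 * INR k + 1) / (INR k + 1)).
Proof.
  unfold binom, Binomial.C.
  replace (2 * S k - S k)%nat with (S k) by lia.
  replace (2 * k - k)%nat with k by lia.
  replace (2 * S k)%nat with (S (S (2 * k))) by lia.
  rewrite !fact_simpl, !mult_INR, !S_INR, mult_INR.
  simpl (INR 2).
  assert (H := INR_fact_neq_0 k). assert (Hk := pos_INR k).
  field. split; [lra | exact H].
Qed.

(** The product of 2i / (2i - 1) for i = 1, ..., k, as in Wallis' formula. *)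
Definition wallis (k : nat) : R := 4 ^ k / binom (2 * k) k.

Lemma wallis_pos (k : nat) : 0 < wallis k.
Proof.
  apply Rdiv_lt_0_compat; [apply pow_lt; lra | apply binom_pos].
Qed.

Lemma wallis_0 : wallis 0 = 1.
Proof. unfold wallis, binom, Binomial.C. simpl. field. Qed.

Lemma wallis_succ (k : nat) :
  wallis (S k) = wallis k * (2 * (INR k + 1) / (2 * INR k + 1)).
Proof.
  unfold wallis. rewrite central_binom_succ. simpl (4 ^ S k).
  assert (H := binom_pos (2 * k) k). assert (Hk := pos_INR k).
  field. repeat split; lra.
Qed.

(** The induction closes because (4x + 1) (2(x + 1) / (2x + 1))^2 falls short of 4x + 5 by exactly 1
    / (2x + 1)^2. *)
Lemma wallis_sqr_le (k : nat) : wallis k ^ 2 <= 4 * INR k + 1.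
Proof.
  induction k as [|k IH].
  - rewrite wallis_0. simpl. lra.
  - rewrite wallis_succ, S_INR. assert (Hk := pos_INR k).
    set (x := INR k) in *.
    apply Rle_trans with ((4 * x + 1) * (2 * (x + 1) / (2 * x + 1)) ^ 2).
    + rewrite Rpow_mult_distr. apply Rmult_le_compat_r; [apply pow2_ge_0 | exact IH].
    + replace ((4 * x + 1) * (2 * (x + 1) / (2 * x + 1)) ^ 2)
        with (4 * (x + 1) + 1 - 1 / (2 * x + 1) ^ 2) by (field; lra).
      assert (0 < 1 / (2 * x + 1) ^ 2).
      { apply Rdiv_lt_0_compat; [lra | apply pow_lt; lra]. }
      lra.
Qed.

Lemma wallis_div_lim : is_lim_seq (fun k => wallis (S k) / INR (S k)) 0.
Proof.
  (* For k >= 1 the squared quotient is at most (4k + 1) / k^2 <= 5 / k. *)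
  apply is_lim_seq_le_le with (fun _ => 0) (fun k => sqrt (5 * / INR (S k))).
  - intros k. assert (H : 0 < INR (S k)) by (apply lt_0_INR; lia).
    assert (Hp : 0 < wallis (S k) / INR (S k))
      by (apply Rdiv_lt_0_compat; [apply wallis_pos | exact H]).
    split; [lra|].
    rewrite <- (sqrt_pow2 (wallis (S k) / INR (S k))) by lra.
    apply sqrt_le_1_alt.
    replace ((wallis (S k) / INR (S k)) ^ 2)
      with (wallis (S k) ^ 2 * / INR (S k) ^ 2) by (field; lra).
    replace (5 * / INR (S k)) with ((5 * INR (S k)) * / INR (S k) ^ 2) by (field; lra).
    apply Rmult_le_compat_r.
    + left. apply Rinv_0_lt_compat, pow_lt, H.
    + assert (W := wallis_sqr_le (S k)). rewrite S_INR in *.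
      assert (P := pos_INR k). lra.
  - apply is_lim_seq_const.
  - replace (Finite 0) with (Finite (sqrt 0)) by now rewrite sqrt_0.
    apply (is_lim_seq_continuous sqrt).
    + apply continuity_pt_sqrt. lra.
    + replace (Finite 0) with (Rbar_mult 5 0) by (simpl; f_equal; ring).
      apply is_lim_seq_scal_l.
      apply (is_lim_seq_incr_1 (fun k => / INR k)).
      replace (Finite 0) with (Rbar_inv p_infty) by reflexivity.
      apply is_lim_seq_inv; [apply is_lim_seq_INR | discriminate].
Qed.

(** * The series: convergence, monotonicity in [n] and recurrence *)

Lemma summand_wallis (n k : nat) :
  summand n (S k) = wallis (S k) / (INR (S k) * (2 * INR (S k) + INR n)).
Proof.
  unfold summand, wallis. assert (H := binom_pos (2 * S k) (S k)).
  assert (Hk := pos_INR k). assert (Hn := pos_INR n). rewrite !S_INR.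
  field. repeat split; lra.
Qed.

Lemma summand_pos (n k : nat) : 0 < summand n (S k).
Proof.
  rewrite summand_wallis. assert (Hn := pos_INR n).
  assert (H : 0 < INR (S k)) by (apply lt_0_INR; lia).
  apply Rdiv_lt_0_compat; [apply wallis_pos | apply Rmult_lt_0_compat; lra].
Qed.

Lemma summand_succ_le (n k : nat) : summand (S n) (S k) <= summand n (S k).
Proof.
  rewrite !summand_wallis, (S_INR n).
  assert (Hn := pos_INR n). assert (H : 0 < INR (S k)) by (apply lt_0_INR; lia).
  apply Rmult_le_compat_l; [left; apply wallis_pos|].
  apply Rinv_le_contravar.
  - apply Rmult_lt_0_compat; lra.
  - apply Rmult_le_compat_l; lra.
Qed.

(** With a = [wallis], a(k)/k - a(k+1)/(k+1) = a(k) (1/k - 2/(2k+1)), which is the summand for n =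
    1. *)
Lemma is_series_summand_1 : is_series (fun i => summand 1 (S i)) 2.
Proof.
  assert (T := is_series_telescope _ _ wallis_div_lim). cbv beta in T.
  replace 2 with (wallis 1 / INR 1 - 0)
    by (rewrite wallis_succ, wallis_0; simpl; field).
  revert T. apply is_series_ext. intros k.
  rewrite summand_wallis, (wallis_succ (S k)), !S_INR.
  assert (Hk := pos_INR k). simpl (INR 0).
  match goal with |- ?a = ?b => change (@eq R a b) end.
  field. repeat split; lra.
Qed.

Lemma ex_series_summand (n : nat) : ex_series (fun i => summand n (S i)).
Proof.
  induction n as [|n IH].
  (* The terms for n = 0 and n = 1 have ratio (2k + 1) / (2k), which is largest at k = 1, where it
     is 3/2. *)
  - apply (@ex_series_le R_AbsRing R_CompleteNormedModule)
      with (fun i => 3 / 2 * summand 1 (S i)).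
    + intros k. change (Rabs (summand 0 (S k)) <= 3 / 2 * summand 1 (S k)).
      rewrite Rabs_pos_eq by (left; apply summand_pos).
      rewrite !summand_wallis, S_INR. simpl (INR 0). simpl (INR 1).
      assert (Hk := pos_INR k). assert (W := wallis_pos (S k)).
      set (x := INR k) in *.
      apply Rminus_le_0.
      replace (_ - _) with
        (wallis (S k) * (x / (2 * (x + 1) ^ 2 * (2 * x + 3)))) by (field; lra).
      apply Rmult_le_pos; [lra|]. apply Rdiv_le_0_compat; [exact Hk|].
      apply Rmult_lt_0_compat; [|lra].
      apply Rmult_lt_0_compat; [lra|]. apply pow_lt; lra.
    + apply (ex_series_scal_l (3 / 2) (fun i => summand 1 (S i))).
      exists 2. apply is_series_summand_1.
  - apply (@ex_series_le R_AbsRing R_CompleteNormedModule)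
      with (fun i => summand n (S i)); [|exact IH].
    intros k. change (Rabs (summand (S n) (S k)) <= summand n (S k)).
    rewrite Rabs_pos_eq by (left; apply summand_pos).
    apply summand_succ_le.
Qed.

(** The recurrence shared by the series and by twice the sine moments. *)
Definition step_rec (u : nat -> R) : Prop :=
  forall n : nat,
    u (S (S n)) = (INR n + 1) / (INR n + 2) * u n + 2 / (INR n + 2) ^ 2.

(** [Series] starts at index 0, so k = i + 1. *)
Definition series_sum (n : nat) : R := Series (fun i => summand n (S i)).

Lemma series_sum_decr (n : nat) : series_sum (S n) <= series_sum n.
Proof.
  apply Series_le; [|apply ex_series_summand].
  intros k. split; [left; apply summand_pos | apply summand_succ_le].
Qed.

Lemma series_sum_1 : series_sum 1 = 2.
Proof. apply is_series_unique, is_series_summand_1. Qed.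

Lemma series_sum_rec : step_rec series_sum.
Proof.
  intros n. assert (Hn := pos_INR n).
  (* Chosen so that [b k - b (S k)] is n + 2 times the summand for n + 2 minus n + 1 times the
     summand for n, both at k + 1. Moreover [b 0] is 2 / (n + 2). *)
  set (b k := wallis (S k) * (2 * INR (S k) - 1) /
              (INR (S k) * (2 * INR (S k) + INR n))).
  assert (Hb : is_lim_seq b 0).
  { apply is_lim_seq_le_le with (fun _ => 0) (fun k => wallis (S k) / INR (S k)).
    - intros k. unfold b. assert (W := wallis_pos (S k)). rewrite S_INR.
      assert (Hk := pos_INR k). split.
      + apply Rdiv_le_0_compat.
        * apply Rmult_le_pos; lra.
        * apply Rmult_lt_0_compat; lra.
      + apply Rminus_le_0.
        replace (_ - _) with
          (wallis (S k) * ((INR n + 1) / ((INR k + 1) * (2 * (INR k + 1) + INR n))))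
          by (field; lra).
        apply Rmult_le_pos; [lra|]. apply Rdiv_le_0_compat; [lra|].
        apply Rmult_lt_0_compat; lra.
    - apply is_lim_seq_const.
    - apply wallis_div_lim. }
  apply is_series_telescope in Hb.
  apply is_series_unique. unfold series_sum.
  replace ((INR n + 1) / (INR n + 2) * Series (fun i => summand n (S i)) +
           2 / (INR n + 2) ^ 2)
    with (plus (scal ((INR n + 1) / (INR n + 2)) (Series (fun i => summand n (S i))))
               (scal (/ (INR n + 2)) (b O - 0))).
  2:{ unfold b, plus, scal, mult; simpl. unfold mult; simpl.
      rewrite wallis_succ, wallis_0. simpl (INR 0). field. lra. }
  assert (H := is_series_plus _ _ _ _
    (is_series_scal ((INR n + 1) / (INR n + 2)) _ _
       (Series_correct _ (ex_series_summand n)))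
    (is_series_scal (/ (INR n + 2)) _ _ Hb)).
  revert H. apply is_series_ext. intros k.
  unfold b, plus, scal; cbn -[INR]. unfold mult; cbn -[INR].
  rewrite !summand_wallis, (wallis_succ (S k)), !S_INR.
  assert (Hk := pos_INR k).
  match goal with |- ?a = ?b => change (@eq R a b) end.
  field. repeat split; lra.
Qed.

(** * Moments of powers of the sine *)

Definition sin_moment (n : nat) : R := RInt (fun x => x * sin x ^ n) 0 (PI / 2).

Lemma ex_RInt_sin_moment (n : nat) (a b : R) : ex_RInt (fun x => x * sin x ^ n) a b.
Proof.
  apply (@ex_RInt_continuous R_CompleteNormedModule). intros x _.
  apply (@ex_derive_continuous R_AbsRing R_NormedModule). auto_derive. exact I.
Qed.

Lemma sin_moment_antiderivative (n : nat) (F : R -> R) :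
  (forall x, is_derive F x (x * sin x ^ n)) ->
  sin_moment n = F (PI / 2) - F 0.
Proof.
  intros HF. apply is_RInt_unique.
  apply (is_RInt_derive F (fun x => x * sin x ^ n)).
  - intros x _. apply HF.
  - intros x _. apply (@ex_derive_continuous R_AbsRing R_NormedModule).
    auto_derive. exact I.
Qed.

Lemma sin_moment_0 : sin_moment 0 = PI ^ 2 / 8.
Proof.
  rewrite (sin_moment_antiderivative 0 (fun x => x ^ 2 / 2)).
  - field.
  - intros x. auto_derive; [exact I|]. simpl. field.
Qed.

Lemma sin_moment_1 : sin_moment 1 = 1.
Proof.
  rewrite (sin_moment_antiderivative 1 (fun x => sin x - x * cos x)).
  - rewrite sin_PI2, cos_PI2, sin_0. ring.
  - intros x. auto_derive; [exact I|]. ring.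
Qed.

Lemma sin_moment_decr (n : nat) : sin_moment (S n) <= sin_moment n.
Proof.
  assert (P := PI_RGT_0).
  apply RInt_le; [lra | apply ex_RInt_sin_moment | apply ex_RInt_sin_moment |].
  intros x Hx. apply Rmult_le_compat_l; [lra|]. simpl.
  rewrite <- (Rmult_1_l (sin x ^ n)) at 2.
  apply Rmult_le_compat_r; [|apply SIN_bound].
  apply pow_le, sin_ge_0; lra.
Qed.

Lemma sin_moment_rec : step_rec (fun n => 2 * sin_moment n).
Proof.
  intros n. assert (Hn := pos_INR n).
  (* The boundary term of integrating x sin^(n+1) x against sin x by parts, plus an antiderivative
     of sin^(n+1) x cos x. It vanishes at 0 and equals 1 / (n + 2) at PI/2. *)
  set (F x := - x * cos x * sin x ^ S n + sin x ^ S (S n) / (INR n + 2)).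
  assert (HF : is_RInt (fun x => (INR n + 2) * (x * sin x ^ S (S n)) -
                                 (INR n + 1) * (x * sin x ^ n)) 0 (PI / 2)
                 (F (PI / 2) - F 0)).
  { apply (is_RInt_derive F).
    - intros x _. unfold F. auto_derive; [lra|].
      change (match n with O => 1 | S _ => INR n + 1 end) with (INR (S n)).
      rewrite !S_INR. simpl.
      assert (E : cos x * cos x = 1 - sin x * sin x).
      { assert (H := sin2_cos2 x). unfold Rsqr in H. lra. }
      field_simplify; [|lra..].
      replace (cos x ^ 2) with (1 - sin x * sin x) by (rewrite <- E; ring).
      field. lra.
    - intros x _. apply (@ex_derive_continuous R_AbsRing R_NormedModule).
      auto_derive. exact I. }
  assert (HK : is_RInt (fun x => (INR n + 2) * (x * sin x ^ S (S n)) -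
                                 (INR n + 1) * (x * sin x ^ n)) 0 (PI / 2)
                 ((INR n + 2) * sin_moment (S (S n)) - (INR n + 1) * sin_moment n)).
  { apply (@is_RInt_minus R_NormedModule);
      apply (@is_RInt_scal R_NormedModule);
      apply (@RInt_correct R_CompleteNormedModule), ex_RInt_sin_moment. }
  apply (@is_RInt_unique R_CompleteNormedModule) in HF.
  apply (@is_RInt_unique R_CompleteNormedModule) in HK.
  rewrite HF in HK. unfold F in HK.
  rewrite sin_PI2, cos_PI2, sin_0, !pow1, !pow_i in HK by lia.
  apply Rmult_eq_reg_l with (INR n + 2); [|lra].
  replace ((INR n + 2) * (2 * sin_moment (S (S n))))
    with (2 * ((INR n + 1) * sin_moment n) +
          2 * ((INR n + 2) * sin_moment (S (S n)) - (INR n + 1) * sin_moment n))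
    by ring.
  rewrite <- HK. field. lra.
Qed.

(** * Comparison of the series with the moments, and the value at n = 0 *)

Lemma series_sum_odd (m : nat) :
  series_sum (S (2 * m)) = 2 * sin_moment (S (2 * m)).
Proof.
  induction m as [|m IH].
  - simpl (S (2 * 0)). rewrite series_sum_1, sin_moment_1. ring.
  - replace (S (2 * S m)) with (S (S (S (2 * m)))) by lia.
    rewrite series_sum_rec, IH. symmetry. apply sin_moment_rec.
Qed.

(** The inhomogeneous terms cancel in the difference, so each step from 2m to 2m + 2 multiplies it
    by (2m + 1) / (2m + 2), the inverse of the growth factor of [wallis]. *)
Lemma series_sum_0_defect (m : nat) :
  series_sum 0 - 2 * sin_moment 0 =
  wallis m * (series_sum (2 * m) - 2 * sin_moment (2 * m)).
Proof.
  induction m as [|m IH].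
  - rewrite wallis_0. simpl (2 * 0)%nat. ring.
  - rewrite IH. replace (2 * S m)%nat with (S (S (2 * m))) by lia.
    rewrite series_sum_rec, (sin_moment_rec (2 * m)%nat), wallis_succ.
    rewrite mult_INR. simpl (INR 2). assert (H := pos_INR m).
    field. repeat split; lra.
Qed.

(** By monotonicity both quantities lie between their values at 2m + 3 and 2m + 1. These values
    agree, so the length of that interval bounds the difference. *)
Lemma series_sum_even_defect (m : nat) :
  Rabs (series_sum (S (S (2 * m))) - 2 * sin_moment (S (S (2 * m))))
    <= 2 / (2 * INR m + 3).
Proof.
  assert (Hm := pos_INR m).
  assert (S1 := series_sum_decr (S (2 * m))).
  assert (S2 := series_sum_decr (S (S (2 * m)))).
  assert (K1 := sin_moment_decr (S (2 * m))).
  assert (K2 := sin_moment_decr (S (S (2 * m)))).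
  assert (O1 := series_sum_odd m). assert (O2 := series_sum_odd (S m)).
  replace (S (2 * S m)) with (S (S (S (2 * m)))) in O2 by lia.
  assert (R := sin_moment_rec (S (2 * m))). cbv beta in R.
  rewrite S_INR, mult_INR in R. simpl (INR 2) in R.
  (* The moments decrease from their value 1 at index 1. *)
  assert (B : sin_moment (S (2 * m)) <= 1).
  { clear -m. induction m as [|m IH].
    - simpl (S (2 * 0)). rewrite sin_moment_1. lra.
    - replace (S (2 * S m)) with (S (S (S (2 * m)))) by lia.
      assert (K1 := sin_moment_decr (S (2 * m))).
      assert (K2 := sin_moment_decr (S (S (2 * m)))). lra. }
  assert (E : 2 * sin_moment (S (2 * m)) - 2 * sin_moment (S (S (S (2 * m))))
              <= 2 / (2 * INR m + 3)).
  { rewrite R. set (k := sin_moment (S (2 * m))) in *. apply Rminus_le_0.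
    replace (_ - _) with (2 * (1 - k) * / (2 * INR m + 3) + 2 / (2 * INR m + 3) ^ 2)
      by (field; lra).
    apply Rplus_le_le_0_compat.
    - apply Rmult_le_pos; [lra|]. left. apply Rinv_0_lt_compat. lra.
    - apply Rdiv_le_0_compat; [lra | apply pow_lt; lra]. }
  apply Rabs_le. lra.
Qed.

Lemma series_sum_0 : series_sum 0 = PI ^ 2 / 4.
Proof.
  (* Squaring lets [wallis_sqr_le] apply without square roots. The constant 8 is not sharp; only the
     decay in m matters. *)
  assert (B : forall m : nat,
    (series_sum 0 - 2 * sin_moment 0) ^ 2 <= 8 * / INR (S m)).
  { intros m. rewrite (series_sum_0_defect (S m)), Rpow_mult_distr.
    assert (W := wallis_sqr_le (S m)). assert (D := series_sum_even_defect m).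
    replace (2 * S m)%nat with (S (S (2 * m))) by lia.
    rewrite S_INR in *. assert (Hm := pos_INR m).
    apply pow_maj_Rabs with (n := 2%nat) in D.
    apply Rle_trans with ((4 * (INR m + 1) + 1) * (2 / (2 * INR m + 3)) ^ 2).
    - apply Rmult_le_compat; try apply pow2_ge_0; assumption.
    - apply Rminus_le_0.
      replace (_ - _) with
        ((16 * INR m ^ 2 + 60 * INR m + 52) / ((INR m + 1) * (2 * INR m + 3) ^ 2))
        by (field; lra).
      apply Rdiv_le_0_compat; [nra|].
      apply Rmult_lt_0_compat; [lra | apply pow_lt; lra]. }
  assert (L : Rbar_le ((series_sum 0 - 2 * sin_moment 0) ^ 2) 0).
  { eapply is_lim_seq_le; [exact B | apply is_lim_seq_const |].
    replace (Finite 0) with (Rbar_mult 8 0) by (simpl; f_equal; ring).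
    apply is_lim_seq_scal_l.
    apply (is_lim_seq_incr_1 (fun k => / INR k)).
    replace (Finite 0) with (Rbar_inv p_infty) by reflexivity.
    apply is_lim_seq_inv; [apply is_lim_seq_INR | discriminate]. }
  simpl Rbar_le in L. rewrite sin_moment_0 in L. nra.
Qed.

(** * Closed forms of the solutions of the recurrence *)

Lemma step_rec_even (u : nat -> R) (m : nat) :
  step_rec u ->
  u (2 * m)%nat =
    binom (2 * m) m / 2 ^ (2 * m + 2) *
    (4 * u O + 2 * sum_n_m (fun j => 4 ^ j / (binom (2 * j) j * INR j ^ 2)) 1 m).
Proof.
  (* With a = [wallis], the increment of a(m) u(2m) from m to m + 1 is a(m+1) / (2 (m+1)^2), a
     multiple of the next term of the sum. *)
  intros Hu. induction m as [|m IH].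
  (* The sum from 1 to 0 is empty. *)
  - rewrite sum_n_m_zero by lia. unfold zero, binom, Binomial.C; simpl. field.
  - replace (2 * S m)%nat with (S (S (2 * m))) at 1 by lia.
    rewrite Hu, IH, sum_n_Sm by lia.
    replace (2 * S m + 2)%nat with (2 * m + 2 + 2)%nat by lia.
    replace (4 ^ S m) with (2 ^ (2 * m + 2)).
    2:{ replace (2 * m + 2)%nat with (2 * S m)%nat by lia.
        rewrite pow_mult. f_equal. ring. }
    rewrite central_binom_succ, (pow_add _ (2 * m + 2) 2), mult_INR, !S_INR.
    unfold plus; cbn -[INR pow sum_n_m binom Nat.mul Nat.add]. simpl (INR 0).
    set (s := sum_n_m _ _ _). set (p := 2 ^ (2 * m + 2)).
    assert (Hp : 0 < p) by (apply pow_lt; lra).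
    assert (H := binom_pos (2 * m) m). assert (Hm := pos_INR m).
    field. repeat split; lra.
Qed.

(** Here (2m + 1) / [wallis m] is the integrating factor: multiplying u(2m + 1) by it gives
    increments equal to twice the next term of the sum. The initial value 2 is twice the term j =
    0. *)
Lemma step_rec_odd (u : nat -> R) (m : nat) :
  step_rec u -> u 1%nat = 2 ->
  u (S (2 * m)) =
    2 ^ S (2 * m) / (binom (2 * m) m * INR (S (2 * m))) *
    sum_n_m (fun j => binom (2 * j) j / ((2 * INR j + 1) * 4 ^ j)) 0 m.
Proof.
  intros Hu H1. induction m as [|m IH].
  - rewrite sum_n_n. simpl (S (2 * 0)). rewrite H1.
    unfold binom, Binomial.C; simpl. field.
  - replace (S (2 * S m)) with (S (S (S (2 * m)))) by lia.
    rewrite Hu, IH, sum_n_Sm by lia.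
    replace (4 ^ S m) with (2 * 2 ^ S (2 * m)).
    2:{ change (2 * 2 ^ S (2 * m)) with (2 ^ S (S (2 * m))).
        replace (S (S (2 * m))) with (2 * S m)%nat by lia.
        rewrite pow_mult. f_equal. ring. }
    rewrite central_binom_succ, !S_INR, mult_INR.
    change (2 ^ S (S (S (2 * m)))) with (2 * (2 * 2 ^ S (2 * m))).
    unfold plus; cbn -[INR pow sum_n_m binom Nat.mul Nat.add]. simpl (INR 2).
    set (s := sum_n_m _ _ _). set (p := 2 ^ S (2 * m)).
    assert (Hp : 0 < p) by (apply pow_lt; lra).
    assert (H := binom_pos (2 * m) m). assert (Hm := pos_INR m).
    field. repeat split; lra.
Qed.

Theorem corollary5p3 :
  (forall n : nat, Nat.Even n ->
     is_series (fun i : nat => summand n (S i))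
       (binom n (n / 2) / 2 ^ (n + 2) *
        (PI ^ 2 +
         2 * sum_n_m (fun j : nat => 4 ^ j / (binom (2 * j) j * INR j ^ 2))
               1 (n / 2))))
  /\
  (forall n : nat, Nat.Odd n ->
     is_series (fun i : nat => summand n (S i))
       (2 ^ n / (binom (n - 1) ((n - 1) / 2) * INR n) *
        sum_n_m (fun j : nat => binom (2 * j) j / ((2 * INR j + 1) * 4 ^ j))
          0 ((n - 1) / 2))).
Proof.
  split.
  - intros n [m ->].
    replace (2 * m / 2)%nat with m by (rewrite Nat.mul_comm, Nat.div_mul; lia).
    replace (PI ^ 2) with (4 * series_sum 0) by (rewrite series_sum_0; field).
    rewrite <- (step_rec_even series_sum m series_sum_rec).
    apply Series_correct, ex_series_summand.
  - intros n [m ->].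
    replace (2 * m + 1)%nat with (S (2 * m)) by lia.
    replace (S (2 * m) - 1)%nat with (2 * m)%nat by lia.
    replace (2 * m / 2)%nat with m by (rewrite Nat.mul_comm, Nat.div_mul; lia).
    rewrite <- (step_rec_odd series_sum m series_sum_rec series_sum_1).
    apply Series_correct, ex_series_summand.
Qed.
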